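(* For every $\rho<1/3$ there exist $\delta>0$ and constants $C_0,c_0>0$ (depending only on $\rho$) such that for every $d\ge1$, the conductance $\mathsf C$ of the MALA chain with standard Gaussian target $\pi=\mathcal N(0,I_d)$ and step size $h=d^{-\rho}$ satisfies $$\mathsf C\le C_0\exp\bigl(-c_0\,d^{\delta}\bigr).$$
   Context: MALA with target $\pi=\mathcal N(0,I_d)$ and step size $h>0$: the proposal kernel $Q(x,\cdot)$ is the Gaussian $\mathcal N((1-h)x,2hI_d)$ with density $Q(x,y)$ (i.e. the potential is $V(x)=\|x\|^2/2$); acceptance probability $A(x,y)=\min\bigl\{1,\frac{\pi(y)Q(y,x)}{\pi(x)Q(x,y)}\bigr\}$; the MALA kernel is $T(x,B)=\int_BQ(x,y)A(x,y)\,dy+\mathbf 1_B(x)\bigl(1-\int_{\mathbb R^d}Q(x,y)A(x,y)\,dy\bigr)$. The conductance is $\mathsf C=\inf\bigl\{\frac{\int_ST(x,S^{c})\,\pi(dx)}{\pi(S)}: S\subseteq\mathbb R^d\text{ measurable},\ 0<\pi(S)\le\frac12\bigr\}$. *)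

(* Defs.v *)
From HB Require Import structures.
From mathcomp Require Import all_boot all_order all_algebra.
From mathcomp Require Import all_classical all_reals all_analysis.
From mathcomp Require Import measurable_realfun ring lra.

Set Implicit Arguments.
Unset Strict Implicit.
Unset Printing Implicit Defensive.

Import Order.TTheory GRing.Theory Num.Theory.
Import numFieldNormedType.Exports.

Local Open Scope classical_set_scope.
Local Open Scope ring_scope.

(** The Borel measurable space [R^d]: the library equips [d]-tuples with the
    product sigma-algebra, and [measurableTypeR R] carries the Borel sets. *)
Notation Rn R d := (d.-tuple (measurableTypeR R)).

Section lebesgue_measure_Rn.
Context {R : realType}.

Definition Rn_cons d (p : measurableTypeR R * Rn R d) : Rn R d.+1 :=
  [tuple of p.1 :: p.2].

Lemma measurable_Rn_cons d : measurable_fun [set: _] (@Rn_cons d).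
Proof. by apply: measurable_cons; [exact: measurable_fst|exact: measurable_snd]. Qed.

HB.instance Definition _ d :=
  isMeasurableFun.Build _ _ _ _ (@Rn_cons d) (@measurable_Rn_cons d).

(** Lebesgue measure on [R^d]: unit mass on the one-point space [R^0], and the
    product of the Lebesgue measures of [R] and [R^d] transported to [R^(d+1)]. *)
Fixpoint lebesgue_Rn d : set (Rn R d) -> \bar R :=
  match d with
  | 0 => \d_([tuple] : Rn R 0)
  | d'.+1 => pushforward (lebesgue_measure \x @lebesgue_Rn d')%E (@Rn_cons d')
  end.

Let Rn_uncons d (x : Rn R d.+1) : measurableTypeR R * Rn R d :=
  (thead x, [tuple of behead x]).

Let measurable_Rn_uncons d : measurable_fun [set: _] (@Rn_uncons d).
Proof.
apply/measurable_fun_pairP; split; first exact: measurable_tnth.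
exact: measurable_behead.
Qed.

Let Rn_consK d : cancel (@Rn_cons d) (@Rn_uncons d).
Proof.
by move=> [a x]; rewrite /Rn_cons /Rn_uncons theadE; congr pair; exact/val_inj.
Qed.

Let Rn_unconsK d : cancel (@Rn_uncons d) (@Rn_cons d).
Proof. by move=> x; rewrite /Rn_cons /Rn_uncons /= -tuple_eta. Qed.

Let lebesgue_Rn_bundled d : {mu : {sigma_finite_measure set (Rn R d) -> \bar R} |
  mu = @lebesgue_Rn d :> (set (Rn R d) -> \bar R)}.
Proof.
elim: d => [|d [mu muE]]; first by exists (\d_([tuple] : Rn R 0)).
pose nu : {measure set (Rn R d.+1) -> \bar R} :=
  measure_function_pushforward__canonical__measure_function_Measure
    (lebesgue_measure \x mu)%E (@measurable_Rn_cons d).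
have nu_sfin : sigma_finite setT nu.
  have /sigma_finiteP[F [TF ndF Foo]] := sigma_finiteT (@lebesgue_measure R).
  have /sigma_finiteP[G [TG ndG Goo]] := sigma_finiteT mu.
  exists (fun n => @Rn_uncons d @^-1` (F n `*` G n)).
    rewrite -preimage_bigcup; apply/esym/seteqP; split => // x _ /=.
    have : (\bigcup_i F i) (thead x) by rewrite -TF.
    have : (\bigcup_i G i) [tuple of behead x] by rewrite -TG.
    move=> [k _ Gky] [n _ Fnx]; exists (maxn n k) => //; split => /=.
    - by move: Fnx; exact/subsetPset/ndF/leq_maxl.
    - by move: Gky; exact/subsetPset/ndG/leq_maxr.
  move=> n; have [mF Fn] := Foo n; have [mG Gn] := Goo n.
  have mFG : measurable (F n `*` G n) by exact: measurableX.
  split; first by rewrite -[X in measurable X]setTI; exact: measurable_Rn_uncons.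
  rewrite /nu /= /pushforward -comp_preimage (_ : _ \o _ = idfun); last first.
    by apply/funext => p; exact: Rn_consK.
  by rewrite preimage_id product_measure1E// lte_mul_pinfty// ge0_fin_numE.
pose sf := Measure_isSigmaFinite.Build _ _ _ nu nu_sfin.
pose nu' : {sigma_finite_measure set _ -> \bar R} :=
  HB.pack (nu : set (Rn R d.+1) -> \bar R) (Measure.on nu) sf.
by exists nu'; rewrite /= -muE.
Qed.

Let lebesgue_Rn0 d : @lebesgue_Rn d set0 = 0%E.
Proof. by have [mu <-] := lebesgue_Rn_bundled d; exact: measure0. Qed.

Let lebesgue_Rn_ge0 d A : (0 <= @lebesgue_Rn d A)%E.
Proof. by have [mu <-] := lebesgue_Rn_bundled d; exact: measure_ge0. Qed.

Let lebesgue_Rn_semi_sigma_additive d : semi_sigma_additive (@lebesgue_Rn d).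
Proof.
have [mu <-] := lebesgue_Rn_bundled d; exact: measure_semi_sigma_additive.
Qed.

HB.instance Definition _ d := isMeasure.Build _ _ _ (@lebesgue_Rn d)
  (@lebesgue_Rn0 d) (@lebesgue_Rn_ge0 d) (@lebesgue_Rn_semi_sigma_additive d).

Let lebesgue_Rn_sigma_finite d : sigma_finite setT (@lebesgue_Rn d).
Proof. by have [mu <-] := lebesgue_Rn_bundled d; exact: sigma_finiteT. Qed.

HB.instance Definition _ d := Measure_isSigmaFinite.Build _ _ _ (@lebesgue_Rn d)
  (@lebesgue_Rn_sigma_finite d).

End lebesgue_measure_Rn.

Section gaussian.
Context {R : realType}.

(** Density and law of [N(m, v I_d)], meant for [v > 0]. *)
Definition gauss_pdf d (m : Rn R d) (v : R) (x : Rn R d) : R :=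
  (2 * pi * v) `^ (- (d%:R / 2)) *
  expR (- (\sum_(i < d) (tnth x i - tnth m i) ^+ 2) / (2 * v)).

Definition gauss_prob d (m : Rn R d) (v : R) (S : set (Rn R d)) : \bar R :=
  (\int[@lebesgue_Rn R d]_(x in S) (gauss_pdf m v x)%:E)%E.

Lemma gauss_pdf_ge0 d (m : Rn R d) v x : 0 <= gauss_pdf m v x.
Proof. by rewrite mulr_ge0 ?powR_ge0 ?expR_ge0. Qed.

Lemma measurable_gauss_pdf d (m : Rn R d) v :
  measurable_fun [set: Rn R d] (gauss_pdf m v).
Proof.
apply: measurable_funM => //; apply: measurableT_comp => //.
apply: measurable_funM => //; apply: measurableT_comp => //.
apply: measurable_sum => i; apply: measurable_funX; apply: measurable_funB => //.
exact: measurable_tnth.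
Qed.

Lemma gauss_pdf_cons d (m : Rn R d.+1) v a (x : Rn R d) : 0 < v ->
  gauss_pdf m v (Rn_cons (a, x)) =
  normal_pdf (thead m) (Num.sqrt v) a * gauss_pdf [tuple of behead m] v x.
Proof.
move=> v0; have sv0 : Num.sqrt v != 0 by rewrite gt_eqF// sqrtr_gt0.
rewrite normal_pdfE// /gauss_pdf /normal_peak /normal_fun sqr_sqrtr ?ltW//.
rewrite mulrACA -expRD; congr *%R.
  have -> : - (d.+1%:R / 2) = - (d%:R / 2) + - (1 / 2) :> R by rewrite -natr1; lra.
  rewrite powRD; last first.
    by apply/implyP => _; rewrite gt_eqF// !mulr_gt0// pi_gt0.
  rewrite mulrC; congr *%R.
  rewrite powRN mul1r powR12_sqrt ?mulr_ge0 ?pi_ge0 ?ltW//.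
  by congr (Num.sqrt _)^-1; ring.
congr expR; rewrite big_ord_recl (mulr_natl v).
rewrite opprD mulrDl; congr (_ + - _ / _).
apply: eq_bigr => i _; congr ((_ - _) ^+ 2); first by rewrite tnthS.
by rewrite [RHS](tnth_nth 0)/= nth_behead [LHS](tnth_nth 0).
Qed.

Lemma integral_gauss_pdf d (m : Rn R d) v : 0 < v ->
  (\int[@lebesgue_Rn R d]_x (gauss_pdf m v x)%:E = 1)%E.
Proof.
move=> v0; elim: d m => [|d IH] m.
  rewrite integral_dirac//; last first.
    by apply/measurable_EFinP; exact: measurable_gauss_pdf.
  rewrite diracT mul1e /gauss_pdf mul0r oppr0 powRr0 big_ord0.
  by rewrite oppr0 mul0r expR0 mulr1.
have mg := measurable_gauss_pdf m v.
have -> : @lebesgue_Rn R d.+1 =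
  pushforward (lebesgue_measure \x @lebesgue_Rn R d)%E (@Rn_cons R d) by [].
rewrite (@ge0_integral_pushforward _ _ _ _ _ _ (@measurable_Rn_cons R d)
  (lebesgue_measure \x @lebesgue_Rn R d)%E)//=; last 2 first.
- exact/measurable_EFinP.
- by move=> x _; rewrite lee_fin gauss_pdf_ge0.
rewrite preimage_setT fubini_tonelli1/=; last 2 first.
- apply/measurable_EFinP; apply: measurableT_comp => //.
- by move=> x; rewrite lee_fin gauss_pdf_ge0.
rewrite -[RHS](integral_normal_pdf (thead m) (Num.sqrt v)).
apply: eq_integral => a _; rewrite /fubini_F /=.
under eq_integral do rewrite gauss_pdf_cons// EFinM.
rewrite ge0_integralZl//; first by rewrite IH mule1.
- by apply/measurable_EFinP; exact: measurable_gauss_pdf.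
- by move=> x _; rewrite lee_fin gauss_pdf_ge0.
- by rewrite lee_fin normal_pdf_ge0.
Qed.

Let gauss_prob0 d (m : Rn R d) v : gauss_prob m v set0 = 0%E.
Proof. by rewrite /gauss_prob integral_set0. Qed.

Let gauss_prob_ge0 d (m : Rn R d) v S : (0 <= gauss_prob m v S)%E.
Proof. by apply: integral_ge0 => x _; rewrite lee_fin gauss_pdf_ge0. Qed.

Let gauss_prob_semi_sigma_additive d (m : Rn R d) v :
  semi_sigma_additive (gauss_prob m v).
Proof.
move=> /= F mF tF mUF.
rewrite /gauss_prob ge0_integral_bigcup//=; last 2 first.
- apply/measurable_EFinP; apply: measurable_funTS.
  exact: measurable_gauss_pdf.
- by move=> x _; rewrite lee_fin gauss_pdf_ge0.
apply: is_cvg_ereal_nneg_natsum_cond => n _ _.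
by apply: integral_ge0 => x _; rewrite lee_fin gauss_pdf_ge0.
Qed.

HB.instance Definition _ d (m : Rn R d) v := isMeasure.Build _ _ _
  (gauss_prob m v) (@gauss_prob0 d m v) (@gauss_prob_ge0 d m v)
  (@gauss_prob_semi_sigma_additive d m v).

End gaussian.

Section conductance.
Local Open Scope ereal_scope.

Definition conductance {R : realType} {disp : measure_display}
    {X : measurableType disp} (mu : probability X R) (T : X -> set X -> \bar R) :
    \bar R :=
  ereal_inf [set (\int[mu]_(x in S) T x (~` S)) / mu S | S in
    [set S : set X | [/\ measurable S, 0 < mu S & mu S <= (2^-1)%:E]]].

End conductance.

Section mala.
Context {R : realType} {d : nat}.

Definition target_pdf : Rn R d -> R := gauss_pdf [tuple 0 | _ < d] 1.

Definition target : set (Rn R d) -> \bar R := gauss_prob [tuple 0 | _ < d] 1.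

HB.instance Definition _ := Measure.on target.

Let target_setT : target [set: _] = 1%E.
Proof. by rewrite /target /gauss_prob integral_gauss_pdf. Qed.

HB.instance Definition _ := @Measure_isProbability.Build _ _ R target target_setT.

Variable h : R.

(** Density of [N(x - h grad V(x), 2h I_d)] for the potential
    [V(x) = |x|^2 / 2], so that the mean is [(1 - h) x]. *)
Definition proposal_pdf (x : Rn R d) : Rn R d -> R :=
  gauss_pdf [tuple (1 - h) * tnth x i | i < d] (2 * h).

Definition acceptance (x y : Rn R d) : R :=
  Num.min 1 ((target_pdf y * proposal_pdf y x) / (target_pdf x * proposal_pdf x y)).

(** The second summand is the mass of the rejected proposals, left at [x]. *)
Definition mala_kernel (x : Rn R d) (B : set (Rn R d)) : \bar R :=
  (\int[@lebesgue_Rn R d]_(y in B) (proposal_pdf x y * acceptance x y)%:E +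
   (\1_B x)%:E *
     (1 - \int[@lebesgue_Rn R d]_y (proposal_pdf x y * acceptance x y)%:E))%E.

End mala.

(* Main.v *)
Require Import Defs.
From mathcomp Require Import all_boot all_order all_algebra.
From mathcomp Require Import all_classical all_reals all_analysis.
From mathcomp Require Import measurable_realfun ring lra.

Import Order.TTheory GRing.Theory Num.Theory.
Import numFieldNormedType.Exports.

Local Open Scope classical_set_scope.
Local Open Scope ring_scope.

(** The chain leaves no set faster than it accepts proposals, and with a step
    [h] much larger than [d^(-1/3)] it accepts almost none. The mass accepted
    in stationarity is the double integral of [min a b], where
    [a = pi(x) Q(x, y)] and [b = pi(y) Q(y, x)] are the densities of a proposed
    move and of its reversal. As [min a b <= sqrt (a b)], it is at most the
    Hellinger affinity of these two densities. Both are centred Gaussian on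
    [R^(2d)], so the affinity is explicit: [(1 + h^3 / 8)^(-d / 2)], for every
    [h > 0].

    Instead of computing a [2d]-dimensional Gaussian integral, [affinityE]
    factors [sqrt (a b)], by completing the square in [y] and then in [x], as
    the affinity times a Gaussian density in [x] times a Gaussian density in
    [y] whose mean is proportional to [x]; two integrations of a probability
    density then suffice. This bounds the flow out of every measurable [S]
    ([flow_le_affinity]), hence the conductance by the affinity divided by
    [pi(S)]. A half-space [{x_1 in A}], with [A] a half-line, has a mass that
    does not depend on [d]; one of the two half-lines at [0] has mass at most
    [1/2] ([half_line_mass]).

    For [h = d^(-rho)] one has [d h^3 = d^(1 - 3 rho)], and
    [ln (1 + u) >= u / (1 + u)] turns the affinity into
    [exp (- d^delta / 18)] with [delta = min 1 (1 - 3 rho)]. The cap at [1] is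
    for [rho < 0], where [h^3] is large and the logarithm is only bounded below
    by a constant ([affinity_le]). *)

(** * Integrals of nonnegative functions *)

Section integration.
Context {disp : measure_display} {T : measurableType disp} {R : realType}.
Local Open Scope ereal_scope.

(** Monotonicity holds without measurability because the integral of a
    nonnegative function is a supremum over the simple functions below it. It
    spares the measurability of [x |-> T(x, S^c)] and of the acceptance
    probability. *)
Lemma ge0_le_integral_nonmeasurable (mu : {measure set T -> \bar R}) (D : set T)
    (f g : T -> \bar R) :
  (forall x, D x -> 0 <= f x) -> (forall x, D x -> f x <= g x) ->
  \int[mu]_(x in D) f x <= \int[mu]_(x in D) g x.
Proof.
move=> f0 fg; rewrite !(integral_mkcond D).
have f0' x : 0 <= (f \_ D) x by apply: erestrict_ge0.
have g0' x : 0 <= (g \_ D) x.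
  by apply: erestrict_ge0 => y Dy; exact: le_trans (f0 _ Dy) (fg _ Dy).
rewrite !ge0_integralTE//; apply: ereal_sup_le => _ [/= h hf <-].
by exists h => //= x; apply: le_trans (hf x) _; exact: lee_restrict.
Qed.

Lemma integral_gt0 (mu : {measure set T -> \bar R}) (D : set T) (f : T -> R) :
  measurable D -> measurable_fun D f -> (forall x, 0 < f x)%R -> 0 < mu D ->
  0 < \int[mu]_(x in D) (f x)%:E.
Proof.
move=> mD mf f0 muD; rewrite lt0e integral_ge0 ?andbT; last first.
  by move=> x _; rewrite lee_fin ltW.
apply/eqP => int0.
have : \int[mu]_(x in D) `|(EFin \o f) x| = 0.
  by rewrite -[RHS]int0; apply: eq_integral => x _; rewrite gee0_abs//= lee_fin ltW.
move/(ae_eq_integral_abs mu mD ((measurable_EFinP D f).2 mf)) => [N [mN N0 DN]].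
have : mu D <= mu N.
  apply: le_measure; rewrite ?inE// => x Dx; apply: DN => /= /(_ Dx) /eqP.
  by rewrite eqe gt_eqF.
by rewrite N0 leNgt muD.
Qed.

Import HBNNSimple.

(** Change of measure for a measure with a density: true by definition on
    indicators, hence on simple functions, and in the limit by monotone
    convergence. *)
Lemma ge0_integral_density (mu nu : {measure set T -> \bar R}) (p : T -> R)
    (D : set T) (f : T -> \bar R) :
  measurable_fun [set: T] p -> (forall x, 0 <= p x)%R ->
  (forall A, measurable A -> nu A = \int[mu]_(x in A) (p x)%:E) ->
  measurable D -> measurable_fun D f -> (forall x, D x -> 0 <= f x) ->
  \int[nu]_(x in D) f x = \int[mu]_(x in D) (f x * (p x)%:E).
Proof.
move=> mp p0 nuE mD mf f0; pose g := nnsfun_approx mD mf.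
have mpD : measurable_fun D (EFin \o p).
  by apply/measurable_EFinP; exact: measurable_funTS.
have int_nu : \int[nu]_(x in D) (EFin \o g n) x @[n --> \oo] -->
    \int[nu]_(x in D) f x.
  rewrite (_ : \int[nu]_(x in D) f x =
      \int[nu]_(x in D) limn ((EFin \o g^~ x))); last first.
    by apply: eq_integral => x /[!inE] Dx; apply/esym/cvg_lim => //;
      exact: cvg_nnsfun_approx.
  apply: cvg_monotone_convergence => //.
  - move=> n; apply/measurable_EFinP.
    by apply: (measurable_funS measurableT) => //; exact/measurable_funP.
  - by move=> n x Dx /=; rewrite lee_fin.
  - by move=> x Dx a b ab; rewrite lee_fin; exact/lefP/nd_nnsfun_approx.
have int_mu : \int[mu]_(x in D) ((EFin \o g n) x * (p x)%:E) @[n --> \oo] -->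
    \int[mu]_(x in D) (f x * (p x)%:E).
  rewrite (_ : \int[mu]_(x in D) (f x * (p x)%:E) =
      \int[mu]_(x in D) limn (fun n => (EFin \o g n) x * (p x)%:E)); last first.
    apply: eq_integral => x /[!inE] Dx; apply/esym/cvg_lim => //.
    by apply: cvgeZr => //; exact: cvg_nnsfun_approx.
  apply: cvg_monotone_convergence => //.
  - move=> n; apply: emeasurable_funM => //; apply/measurable_EFinP.
    by apply: (measurable_funS measurableT) => //; exact/measurable_funP.
  - by move=> n x Dx /=; rewrite mule_ge0 ?lee_fin.
  - move=> x Dx a b ab; rewrite lee_wpmul2r ?lee_fin//.
    exact/lefP/nd_nnsfun_approx.
suff int_g n : \int[nu]_(x in D) (EFin \o g n) x =
    \int[mu]_(x in D) ((EFin \o g n) x * (p x)%:E).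
  rewrite -(cvg_lim _ int_nu)// -(cvg_lim _ int_mu)//.
  by congr (limn _); apply/funext.
have ind0 y x : 0 <= (y * \1_(g n @^-1` [set y]) x)%:E :> \bar R.
  exact: nnfun_muleindic_ge0.
have mind y : measurable_fun D
    (fun x => (y * \1_(g n @^-1` [set y]) x)%:E : \bar R).
  by apply: (measurable_comp measurableT) => //; exact: measurable_funM.
transitivity (\int[nu]_(x in D)
   (\sum_(y \in range (g n)) (y * \1_(g n @^-1` [set y]) x)%:E)).
  by apply: eq_integral => x _; rewrite /= fimfunE -fsumEFin.
transitivity (\int[mu]_(x in D)
   (\sum_(y \in range (g n)) ((y * \1_(g n @^-1` [set y]) x)%:E * (p x)%:E)));
   last first.
  apply: eq_integral => x _; rewrite -ge0_mule_fsuml => [|y]; last exact: ind0.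
  by rewrite /= fsumEFin // -(fimfunE _ x).
rewrite ge0_integral_fsum//.
rewrite ge0_integral_fsum//; last 2 first.
- by move=> y; exact: emeasurable_funM.
- by move=> y x _; apply: mule_ge0 => //; rewrite lee_fin.
apply: eq_fsbigr => y /[!inE] -[t _ gty].
have y0 : (0 <= y)%R by rewrite -gty.
under eq_integral do rewrite EFinM.
under [RHS]eq_integral do rewrite EFinM -muleA.
rewrite !ge0_integralZl//; first congr (_ * _).
- rewrite integral_indic// nuE; last exact: measurableI.
  rewrite setIC integral_mkcondr; apply: eq_integral => x _.
  by rewrite epatch_indic muleC.
- by apply: emeasurable_funM => //; apply/measurable_EFinP.
- by move=> x _; rewrite mule_ge0// lee_fin.
- exact/measurable_EFinP.
Qed.

End integration.

(** * The affinity of a proposed move and its reversal *)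

(** The Hellinger affinity of the joint densities [pi(x) Q(x, y)] and
    [pi(y) Q(y, x)]. *)
Definition affinity {R : realType} (d : nat) (h : R) : R :=
  (1 + h ^+ 3 / 8) `^ (- (d%:R / 2)).

Section accepted_flow.
Context {R : realType} {d : nat}.
Implicit Types (h : R) (x y : Rn R d).

Lemma gauss_pdf_gt0 (m : Rn R d) (v : R) x : 0 < v -> 0 < gauss_pdf m v x.
Proof.
by move=> v0; rewrite mulr_gt0 ?expR_gt0// powR_gt0// !mulr_gt0// pi_gt0.
Qed.

(** The normalised geometric mean of the two joint densities is again a Gaussian
    law of a pair [(x, y)]: [affinity_start_pdf] is the density of its marginal
    in [x], [affinity_step_pdf] that of [y] given [x]. *)
Definition affinity_start_pdf h : Rn R d -> R :=
  gauss_pdf [tuple 0 | _ < d] (4 * (2 + h ^+ 2) / (8 + h ^+ 3)).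

Definition affinity_step_pdf h x : Rn R d -> R :=
  gauss_pdf [tuple 2 * (1 - h) / (2 + h ^+ 2) * tnth x i | i < d]
    (4 * h / (2 + h ^+ 2)).

(** Per coordinate, the exponents of both sides are the same quadratic form
    [- (A (x^2 + y^2) - 2 B x y)] with [A = 1 / (2 h) + h / 4] and
    [B = (1 - h) / (2 h)]. Completing squares gives the conditional variance
    [1 / A], the conditional mean [(B / A) x] and the marginal variance
    [A / (A^2 - B^2)]; the normalising constants match because
    [2 h (A^2 - B^2) = 1 + h^3 / 8]. The identity is stated for squares to keep
    square roots of densities out of the computation. *)
Lemma affinityE h x y : 0 < h ->
  (target_pdf x * proposal_pdf h x y) * (target_pdf y * proposal_pdf h y x) =
  (affinity d h * (affinity_start_pdf h x * affinity_step_pdf h x y)) ^+ 2.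
Proof.
move=> h0; have h2 : 0 < 2 + h ^+ 2 by rewrite addr_gt0// exprn_gt0.
have h3 : 0 < 8 + h ^+ 3 by rewrite addr_gt0// exprn_gt0.
rewrite /target_pdf /proposal_pdf /affinity_start_pdf /affinity_step_pdf.
rewrite /affinity /gauss_pdf; set e := - (d%:R / 2).
set w := 4 * (2 + h ^+ 2) / (8 + h ^+ 3); set v := 4 * h / (2 + h ^+ 2).
have w0 : 0 < w by rewrite divr_gt0// mulr_gt0.
have v0 : 0 < v by rewrite divr_gt0// mulr_gt0.
have p2 : 0 < 2 * pi :> R by rewrite mulr_gt0// pi_gt0.
have constE : (2 * pi * 1) `^ e * (2 * pi * (2 * h)) `^ e =
    (1 + h ^+ 3 / 8) `^ e * ((2 * pi * w) `^ e * (2 * pi * v) `^ e) :> R.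
  have k0 : 0 <= 1 + h ^+ 3 / 8 by have := exprn_gt0 3 h0; lra.
  have base0 (r : R) : 0 < r -> 0 <= 2 * pi * r by move=> r0; apply/ltW/mulr_gt0.
  have h20 : 0 < 2 * h by rewrite mulr_gt0.
  rewrite -!powRM ?base0//; last by rewrite mulr_ge0// base0.
  by congr (_ `^ _); rewrite /w /v; field; rewrite !gt_eqF.
set Ex := expR (- _ / (2 * 1)); set Exy := expR (- _ / (2 * (2 * h))).
set Ey := expR (- _ / (2 * 1)); set Eyx := expR (- _ / (2 * (2 * h))).
set Ew := expR (- _ / (2 * w)); set Ev := expR (- _ / (2 * v)).
have expE : Ex * Exy * (Ey * Eyx) = (Ew * Ev) ^+ 2.
  rewrite /Ex /Exy /Ey /Eyx /Ew /Ev -!expRD -expRM_natl; congr expR.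
  rewrite mulrDr !mulNr !mulrN -!opprD !mulr_suml !mulr_sumr -!big_split/=.
  congr (- _); apply: eq_bigr => i _; rewrite !tnth_mktuple /w /v.
  by field; rewrite !gt_eqF.
transitivity (((2 * pi * 1) `^ e * (2 * pi * (2 * h)) `^ e) ^+ 2 *
  (Ex * Exy * (Ey * Eyx))); first by ring.
by rewrite constE expE; ring.
Qed.

(** The accepted density is [min a b], for [a] the joint density of the move and
    [b] that of its reversal, and [(min a b)^2 <= a b]. *)
Lemma accepted_flow_le h x y : 0 < h ->
  target_pdf x * (proposal_pdf h x y * acceptance h x y) <=
  affinity d h * (affinity_start_pdf h x * affinity_step_pdf h x y).
Proof.
move=> h0; rewrite /acceptance mulrA; set a := target_pdf x * _.
set b := target_pdf y * _.
have a0 : 0 < a by rewrite mulr_gt0// gauss_pdf_gt0// mulr_gt0.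
have b0 : 0 < b by rewrite mulr_gt0// gauss_pdf_gt0// mulr_gt0.
rewrite -(@ler_pXn2r _ 2)// ?nnegrE; last 2 first.
- by rewrite mulr_ge0 ?ltW// lt_min ltr01 divr_gt0.
- by rewrite !mulr_ge0 ?powR_ge0 ?gauss_pdf_ge0.
rewrite -affinityE// -/a -/b minr_pMr ?(ltW a0)// mulr1 mulrCA divff ?gt_eqF// mulr1.
by rewrite expr2 ler_pM// ?ge_min ?lexx ?orbT// le_min !ltW.
Qed.

End accepted_flow.

(** * Bounding the conductance by the affinity *)

Section conductance_le_affinity.
Context {R : realType} {d : nat}.
Implicit Types (h : R) (x y : Rn R d).
Local Open Scope ereal_scope.

Lemma mala_kernel_setC h (S : set (Rn R d)) x : S x ->
  mala_kernel h x (~` S) =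
  \int[@lebesgue_Rn R d]_(y in ~` S) (proposal_pdf h x y * acceptance h x y)%:E.
Proof.
by move=> Sx; rewrite /mala_kernel indicE memNset ?mul0e ?adde0//= => /(_ Sx).
Qed.

Lemma acceptance_ge0 h x y : (0 <= acceptance h x y)%R.
Proof.
by rewrite le_min ler01 divr_ge0// mulr_ge0// gauss_pdf_ge0.
Qed.

(** Integrating [accepted_flow_le] in [y] removes the conditional density. *)
Lemma mala_kernel_setC_le h (S : set (Rn R d)) x : (0 < h)%R ->
  measurable S -> S x ->
  mala_kernel h x (~` S) <=
  (affinity d h * affinity_start_pdf h x / target_pdf x)%:E.
Proof.
move=> h0 mS Sx; rewrite mala_kernel_setC//.
have t0 : (0 < target_pdf x)%R by exact: gauss_pdf_gt0.
set c := (_ / _)%R.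
have c0 : (0 <= c)%R.
  by rewrite divr_ge0 ?gauss_pdf_ge0// mulr_ge0 ?powR_ge0 ?gauss_pdf_ge0.
have v0 : (0 < 4 * h / (2 + h ^+ 2))%R.
  by rewrite divr_gt0 ?mulr_gt0// addr_gt0// exprn_gt0.
have mstep : measurable_fun setT (EFin \o affinity_step_pdf h x).
  by apply/measurable_EFinP; exact: measurable_gauss_pdf.
apply: (@le_trans _ _ (\int[@lebesgue_Rn R d]_(y in ~` S)
    (c%:E * (affinity_step_pdf h x y)%:E))).
  apply: ge0_le_integral_nonmeasurable => y _; rewrite lee_fin.
    by rewrite mulr_ge0 ?gauss_pdf_ge0 ?acceptance_ge0.
  rewrite /c [leRHS]mulrAC ler_pdivlMr// [leLHS]mulrC -[leRHS]mulrA; exact: accepted_flow_le.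
apply: (@le_trans _ _ (\int[@lebesgue_Rn R d]_y
    (c%:E * (affinity_step_pdf h x y)%:E))).
  apply: ge0_subset_integral => //; first exact: measurableC.
    exact: emeasurable_funM.
  by move=> y _; rewrite lee_fin mulr_ge0// gauss_pdf_ge0.
rewrite ge0_integralZl// ?integral_gauss_pdf ?mule1//.
by move=> y _; rewrite lee_fin gauss_pdf_ge0.
Qed.

Lemma flow_le_affinity h (S : set (Rn R d)) : (0 < h)%R -> measurable S ->
  \int[@target R d]_(x in S) mala_kernel h x (~` S) <= (affinity d h)%:E.
Proof.
move=> h0 mS.
have mt : measurable_fun setT (@target_pdf R d) by exact: measurable_gauss_pdf.
have ms : measurable_fun setT (@affinity_start_pdf R d h).
  exact: measurable_gauss_pdf.
have w0 : (0 < 4 * (2 + h ^+ 2) / (8 + h ^+ 3))%R.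
  by rewrite divr_gt0 ?mulr_gt0// addr_gt0// exprn_gt0.
have a0 : (0 <= affinity d h)%R by exact: powR_ge0.
have r0 x : (0 <= affinity d h * affinity_start_pdf h x / target_pdf x)%R.
  by rewrite divr_ge0 ?gauss_pdf_ge0// mulr_ge0 ?gauss_pdf_ge0.
apply: (@le_trans _ _ (\int[@target R d]_(x in S)
    (affinity d h * affinity_start_pdf h x / target_pdf x)%:E)).
  apply: ge0_le_integral_nonmeasurable => x Sx; last exact: mala_kernel_setC_le.
  rewrite mala_kernel_setC//; apply: integral_ge0 => y _.
  by rewrite lee_fin mulr_ge0 ?gauss_pdf_ge0 ?acceptance_ge0.
rewrite (@ge0_integral_density _ _ _ (@lebesgue_Rn R d) _ (@target_pdf R d))//.
- apply: (@le_trans _ _ (\int[@lebesgue_Rn R d]_(x in S)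
      ((affinity d h)%:E * (affinity_start_pdf h x)%:E))).
    apply: ge0_le_integral_nonmeasurable => x _; rewrite lee_fin.
      by apply: mulr_ge0 => //; exact: gauss_pdf_ge0.
    by rewrite divfK// gt_eqF// gauss_pdf_gt0.
  apply: (@le_trans _ _ (\int[@lebesgue_Rn R d]_x
      ((affinity d h)%:E * (affinity_start_pdf h x)%:E))).
    apply: ge0_subset_integral => //.
      by apply: emeasurable_funM => //; exact/measurable_EFinP.
    by move=> x _; rewrite lee_fin mulr_ge0 ?gauss_pdf_ge0.
  rewrite ge0_integralZl// ?integral_gauss_pdf ?mule1//.
    exact/measurable_EFinP.
  by move=> x _; rewrite lee_fin gauss_pdf_ge0.
- by move=> x; rewrite gauss_pdf_ge0.
- apply/measurable_EFinP; apply: measurable_funTS; apply: measurable_funM.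
    exact: measurable_funM.
  under eq_fun do rewrite -powR_inv1 ?gauss_pdf_ge0//.
  exact: (measurableT_comp (measurable_powR _)).
- by move=> x _; rewrite lee_fin.
Qed.

(** The bound on the flow does not depend on [S], so it is useful only for sets
    whose mass is bounded away from [0]. *)
Lemma conductance_le_affinity h (S : set (Rn R d)) : (0 < h)%R ->
  measurable S -> 0 < target S -> target S <= (2^-1)%:E ->
  conductance (@target R d) (mala_kernel h) <= (affinity d h)%:E / target S.
Proof.
move=> h0 mS S0 S2.
apply: (@le_trans _ _
    ((\int[@target R d]_(x in S) mala_kernel h x (~` S)) / target S)).
  by apply: ereal_inf_lbound; exists S.
by apply: lee_wpmul2r; [rewrite inve_ge0 ltW|exact: flow_le_affinity].
Qed.

End conductance_le_affinity.

(** * Half-spaces have a mass independent of the dimension *)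

Section half_space.
Context {R : realType}.
Local Open Scope ereal_scope.

Lemma measurable_thead_preimage (d : nat) (A : set (measurableTypeR R)) :
  measurable A -> measurable [set x : Rn R d.+1 | A (thead x)].
Proof.
move=> mA; rewrite -[X in measurable X]setTI.
exact: (@measurable_tnth _ _ _ ord0).
Qed.

(** The standard Gaussian is a product measure, so its first marginal is the
    standard normal law on the line. *)
Lemma target_first_coordinate (d : nat) (A : set (measurableTypeR R)) :
  measurable A ->
  @target R d.+1 [set x | A (thead x)] = normal_prob 0 1 A.
Proof.
move=> mA; have mS := @measurable_thead_preimage d A mA.
rewrite /target /gauss_prob; set S := [set x | _]; set m := [tuple 0%R | _ < _].
have mg : measurable_fun setT (gauss_pdf m 1) by exact: measurable_gauss_pdf.
have -> : @lebesgue_Rn R d.+1 =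
  pushforward (lebesgue_measure \x @lebesgue_Rn R d) (@Rn_cons R d) by [].
rewrite (@ge0_integral_pushforward _ _ _ _ _ _ (@measurable_Rn_cons R d)
  (lebesgue_measure \x @lebesgue_Rn R d))//=; last 2 first.
- by apply/measurable_EFinP; exact: measurable_funTS.
- by move=> x _; rewrite lee_fin gauss_pdf_ge0.
have mconsS : measurable (@Rn_cons R d @^-1` S).
  by rewrite -[X in measurable X]setTI; exact: measurable_Rn_cons.
rewrite integral_mkcond fubini_tonelli1/=; last 2 first.
- apply/(measurable_restrictT _ mconsS)/measurable_funTS/measurable_EFinP.
  exact: measurableT_comp.
- by move=> p; apply: erestrict_ge0 => q _; rewrite lee_fin gauss_pdf_ge0.
rewrite /normal_prob [RHS]integral_mkcond; apply: eq_integral => a _.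
rewrite /fubini_F /= patchE; case: ifPn => [/set_mem|/negP] Aa.
  transitivity (\int[@lebesgue_Rn R d]_x ((normal_pdf 0 1 a)%:E *
      (gauss_pdf [tuple of behead m] 1 x)%:E)).
    apply: eq_integral => x _; rewrite patchE mem_set; last first.
      by rewrite /S /= theadE.
    by rewrite /= gauss_pdf_cons// sqrtr1 EFinM /thead tnth_mktuple.
  rewrite ge0_integralZl// ?integral_gauss_pdf ?mule1//.
  - by apply/measurable_EFinP; exact: measurable_gauss_pdf.
  - by move=> x _; rewrite lee_fin gauss_pdf_ge0.
  - by rewrite lee_fin normal_pdf_ge0.
apply: integral0_eq => x _; rewrite patchE memNset//.
by rewrite /S /= theadE => Aa'; apply/Aa/mem_set.
Qed.

(** The half-lines on either side of [0] both have positive mass and share a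
    total mass of [1], so the lighter one works. *)
Lemma half_line_mass : exists (m : R) (A : set (measurableTypeR R)),
  [/\ (0 < m)%R, (m <= 2^-1)%R, measurable A & normal_prob 0 1 A = m%:E].
Proof.
have pos (A : set (measurableTypeR R)) : measurable A ->
    0 < (@lebesgue_measure R) A -> 0 < @normal_prob R 0 1 A.
  move=> mA A0; apply: integral_gt0 => //.
    by apply: measurable_funTS; exact: measurable_normal_pdf.
  by move=> x; rewrite normal_pdfE// mulr_gt0 ?expR_gt0// normal_peak_gt0.
pose A : set (measurableTypeR R) := `[0%R, +oo[%classic.
have mA : measurable A by exact: measurable_itv.
have AC : ~` A = `]-oo, 0%R[%classic by rewrite setCitvr.
have A0 : 0 < @normal_prob R 0 1 A.
  by apply: pos => //; rewrite lebesgue_measure_itv/= ltry addye.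
have AC0 : 0 < @normal_prob R 0 1 (~` A).
  apply: pos; first exact: measurableC.
  by rewrite AC lebesgue_measure_itv/= ltNyr addey.
have fA : @normal_prob R 0 1 A \is a fin_num by exact: fin_num_measure.
pose m := fine (@normal_prob R 0 1 A).
have mE : @normal_prob R 0 1 A = m%:E by rewrite fineK.
have mCE : @normal_prob R 0 1 (~` A) = (1 - m)%:E.
  by rewrite EFinB -mE; exact: (probability_setC (@normal_prob R 0 1) mA).
rewrite mE lte_fin in A0; rewrite mCE lte_fin in AC0.
have [m2|m2] := leP m (2^-1)%R; first by exists m, A.
exists (1 - m)%R, (~` A); split => //; first by lra.
exact: measurableC.
Qed.

End half_space.

(** * Decay of the affinity for [h = d^(-rho)] *)

Section affinity_decay.
Context {R : realType}.

(** This is [ln y <= y - 1] at [y = (1 + u)^-1]. *)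
Lemma ln1D_ge (u : R) : 0 <= u -> u / (1 + u) <= ln (1 + u).
Proof.
move=> u0; have u1 : 0 < 1 + u by rewrite ltr_pwDl.
have := @le_ln1Dx R ((1 + u)^-1 - 1).
rewrite addrCA subrr addr0 lnV ?posrE// ltrBrDl subrr invr_gt0 => /(_ u1).
have -> : u / (1 + u) = 1 - (1 + u)^-1 by field; rewrite gt_eqF.
by lra.
Qed.

(** With [u = h^3 / 8], minus the logarithm of the affinity is at least
    [(d / 2) u / (1 + u)]. If [h <= 1] this is at least [d h^3 / 18], and if
    [h >= 1] at least [d / 18]. *)
Lemma affinity_le (rho : R) (d : nat) : (1 <= d)%N ->
  affinity d (d%:R `^ (- rho)) <=
  expR (- 18^-1 * d%:R `^ (Num.min 1 (1 - 3 * rho))).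
Proof.
move=> d1; have d1' : 1 <= d%:R :> R by rewrite ler1n.
have d0 : 0 < d%:R :> R by exact: lt_le_trans d1'.
set h := d%:R `^ (- rho); have h0 : 0 < h by exact: powR_gt0.
have h30 : 0 < h ^+ 3 by exact: exprn_gt0.
have dh3 : d%:R * h ^+ 3 = d%:R `^ (1 - 3 * rho).
  rewrite /h -powR_mulrn ?powR_ge0// -powRrM powRD; last first.
    by apply/implyP => _; rewrite gt_eqF.
  by rewrite powRr1 ?ltW//; congr (_ * _ `^ _); ring.
set D := d%:R `^ _.
have D1 : D <= d%:R by rewrite -[leRHS](powRr1 (ltW d0)) ler_powR// ge_min lexx.
have D2 : D <= d%:R * h ^+ 3 by rewrite dh3 ler_powR// ge_min lexx orbT.
rewrite /affinity; set u := h ^+ 3 / 8.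
have u0 : 0 <= u by rewrite divr_ge0// ltW.
have u1 : 0 < 1 + u by rewrite ltr_pwDl.
have -> : 1 + u = expR (ln (1 + u)) by rewrite lnK ?posrE.
rewrite -expRM ler_expR.
suff key : D / 9 <= d%:R * ln (1 + u) by lra.
apply: (@le_trans _ _ (d%:R * (u / (1 + u)))); last first.
  by rewrite ler_pM2l// ln1D_ge.
rewrite mulrA ler_pdivlMr// /u; have [h1|h1] := leP (h ^+ 3) 1.
  apply: (@le_trans _ _ (D / 8)); last by lra.
  have : 0 <= D by exact: powR_ge0.
  by nra.
have : D * h ^+ 3 <= d%:R * h ^+ 3 by rewrite ler_pM2r.
by lra.
Qed.

End affinity_decay.

Theorem proposition39 (R : realType) (rho : R) (hrho : rho < 3^-1) :
  exists delta C0 c0 : R, [/\ 0 < delta, 0 < C0, 0 < c0 &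
    forall d : nat, (1 <= d)%N ->
      (conductance (@target R d) (mala_kernel (d%:R `^ (- rho)))
        <= (C0 * expR (- c0 * d%:R `^ delta))%:E)%E].
Proof.
have [m [A [m0 m2 mA Am]]] := @half_line_mass R.
exists (Num.min 1 (1 - 3 * rho)), m^-1, 18^-1; split.
- by rewrite lt_min ltr01/=; lra.
- by rewrite invr_gt0.
- by rewrite invr_gt0.
case=> // d d1.
have h0 : 0 < d.+1%:R `^ (- rho) :> R by rewrite powR_gt0.
have Sm := target_first_coordinate d A mA; rewrite Am in Sm.
have := conductance_le_affinity _ _ h0 (@measurable_thead_preimage R d A mA).
rewrite Sm lte_fin lee_fin => /(_ m0 m2) /le_trans; apply.
rewrite inver gt_eqF// -EFinM lee_fin mulrC ler_pM2l ?invr_gt0//.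
exact: affinity_le.
Qed.
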